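(* Let $m\ge1$ be an integer and $q\in(1,\infty)$. For each $\beta\in[0,m]$, the set $\mathcal{S}_\beta:=\{\mu\in\mathcal{P}(\mathbb{R}^m): \dim_{L^q}(\mu)=\beta\}$ is dense in $\mathcal{P}(\mathbb{R}^m)$.
   Context: $\mathcal{P}(\mathbb{R}^m)$ is the set of Borel probability measures on $\mathbb{R}^m$, with the metric defined as $$d_L(\mu,\nu)=\sup_{f\in\mathrm{Lip}_1}\Big|\int_{\mathbb{R}^m}f\,d\mu-\int_{\mathbb{R}^m}f\,d\nu\Big|,$$ where $\mathrm{Lip}_1$ is the set of all real-valued Lipschitz functions on $\mathbb{R}^m$ with Lipschitz constant less than or equal to $1$. Density is with respect to $d_L$. For a Borel probability measure $\mu$ on $\mathbb{R}^m$ with bounded support and $q\in(1,\infty)$, the $L^q$ spectrum is $$\tau(\mu,q)=\liminf_{k\to\infty}\frac{-\log\sum_{Q\in D_k^m}\mu(Q)^q}{k},$$ where $\log$ is to base $2$ and $D_k^m$ is the collection of all level-$k$ dyadic cubes $I^1\times\cdots\times I^m$ with each $I^l\in\{[j2^{-k},(j+1)2^{-k}):j\in\mathbb{Z}\}$. The $L^q$ dimension is $\dim_{L^q}(\mu)=\tau(\mu,q)/(q-1)$. Since $\dim_{L^q}$ is defined only for measures with bounded support, the condition $\dim_{L^q}(\mu)=\beta$ includes that $\mu$ has bounded support.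
   Formalization: P(R^m) is restricted to measures with finite first moment: if the first moment is infinite, the truncations min(|x|,n) give infinite d_L-distance to every measure of bounded support, so the claim fails for all excluded measures. *)

(* Defs.v *)
From HB Require Import structures.
From mathcomp Require Import all_boot all_order all_algebra.
From mathcomp Require Import all_classical all_reals all_analysis.

Set Implicit Arguments.
Unset Strict Implicit.
Unset Printing Implicit Defensive.

Import Order.TTheory GRing.Theory Num.Theory.
Import numFieldNormedType.Exports.

Local Open Scope classical_set_scope.
Local Open Scope ring_scope.

(* R^m with its Borel sigma-algebra, the one generated by the open sets. *)
Notation borelRV R m := (g_sigma_algebraType (@open 'rV[R]_m)).

(* The norm carried by 'rV[R]_m in the library is the sup norm; Lipschitz
   constants on R^m are taken with respect to the Euclidean norm. *)
Definition enorm (R : realType) (m : nat) (x : 'rV[R]_m) : R :=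
  Num.sqrt (\sum_(i < m) x 0 i ^+ 2).

Definition Lip1 (R : realType) (m : nat) : set ('rV[R]_m -> R) :=
  [set f | forall x y : 'rV[R]_m, `|f x - f y| <= enorm (x - y)].

Definition dL (R : realType) (m : nat) (mu nu : probability (borelRV R m) R) :
    \bar R :=
  ereal_sup [set `| \int[mu]_(x in [set: borelRV R m]) (f x)%:E -
                    \int[nu]_(x in [set: borelRV R m]) (f x)%:E |%E
            | f in @Lip1 R m].

(* On all Borel probability measures dL is not a metric: if mu has infinite
   first moment, take f to be the Euclidean norm: it lies in Lip1 and is not
   mu-integrable.  The space on which the integrals in dL exist and dL is a
   finite metric consists of the measures with finite first moment. *)
Definition PR (R : realType) (m : nat) : set (probability (borelRV R m) R) :=
  [set mu | (\int[mu]_(x in [set: borelRV R m]) (enorm x)%:E < +oo)%E].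

Definition dense_dL (R : realType) (m : nat)
    (S : set (probability (borelRV R m) R)) : Prop :=
  forall mu, PR mu -> forall e : R, 0 < e ->
    exists nu, [/\ PR nu, S nu & (dL mu nu < e%:E)%E].

Definition supp (R : realType) (m : nat) (mu : probability (borelRV R m) R) :
    set 'rV[R]_m :=
  [set x : 'rV[R]_m | forall U : set 'rV[R]_m, open U -> U x -> (0 < mu U)%E].

Definition dyadic_cube (R : realType) (m k : nat) (j : 'I_m -> int) :
    set 'rV[R]_m :=
  [set x : 'rV[R]_m | forall l : 'I_m,
     (j l)%:~R * 2 ^- k <= x 0 l < (j l + 1)%:~R * 2 ^- k].

Definition dyadic_cubes (R : realType) (m k : nat) : set (set 'rV[R]_m) :=
  [set @dyadic_cube R m k j | j in [set: 'I_m -> int]].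

Definition Lq_sum (R : realType) (m : nat) (mu : probability (borelRV R m) R)
    (q : R) (k : nat) : \bar R :=
  (\esum_(Q in @dyadic_cubes R m k) (mu Q `^ q))%E.

Definition log2 (R : realType) (x : R) : R := ln x / ln 2.

(* For q > 1 one has 0 < Lq_sum mu q k <= 1, so fine loses nothing; the
   junk term at k = 0 does not affect the lower limit. *)
Definition tau (R : realType) (m : nat) (mu : probability (borelRV R m) R)
    (q : R) : \bar R :=
  limn_einf (fun k : nat => (- log2 (fine (Lq_sum mu q k)) / k%:R)%:E).

Definition dimLq (R : realType) (m : nat) (mu : probability (borelRV R m) R)
    (q : R) : \bar R := (tau mu q * ((q - 1)^-1)%:E)%E.

(* dimLq is a total function here; the mathematical one is only defined for
   measures with bounded support. *)
Definition Sbeta (R : realType) (m : nat) (q beta : R) :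
    set (probability (borelRV R m) R) :=
  [set mu | bounded_set (supp mu) /\ dimLq mu q = beta%:E].

(* Main.v *)
(* Couple mu with the uniform distribution on [0, 1].  Given a scale s, move a
   point x to the corner of the level-s dyadic cube containing it (to 0 if x is
   at distance at least s from 0), then refine this corner at the finer dyadic
   levels using the binary digits of an independent uniform variable u: each
   refinement step either consumes m fresh digits of u, one for each coordinate,
   or appends zeros.  If n k of the first k steps consume digits, the law nu of
   the resulting point gives mass at most M = 2^-(m n k) to every cube of level
   k + s, and mass at least p M to 2^(m n k) of them, where p > 0 is the mass of
   some starting corner.  Hence the L^q sum at level k + s is between
   p^q M^(q-1) and M^(q-1), and dim_{L^q} nu = lim m n k / k, which is beta for
   n k = floor (beta / m * (k - sqrt k)).  The term sqrt k forces infinitely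
   many steps that append zeros, so that no expansion ends in ones and each
   half-open dyadic cube is exactly determined by the digits consumed so far.
   The cost of the coupling bounds dL mu nu and tends to 0 as s grows, by
   dominated convergence. *)
From HB Require Import structures.
Require Import Defs.
From mathcomp Require Import all_boot all_order all_algebra.
From mathcomp Require Import all_classical all_reals all_analysis.
From mathcomp Require Import measurable_realfun.
From mathcomp Require Import ring lra zify.

Set Implicit Arguments.
Unset Strict Implicit.
Unset Printing Implicit Defensive.

Import Order.TTheory GRing.Theory Num.Theory.
Import numFieldNormedType.Exports.

Local Open Scope classical_set_scope.
Local Open Scope ring_scope.

(** * Schedule of the digit-consuming steps, and points given by dyadic expansions *)

Definition digit_count (R : realType) (alpha : R) (k : nat) : nat :=
  Num.truncn (alpha * (k%:R - Num.sqrt k%:R)).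

Lemma ler_sqrt_nat (R : realType) (k : nat) : Num.sqrt (k%:R : R) <= k%:R.
Proof.
case: k => [|k]; first by rewrite sqrtr0.
rewrite -[leRHS]ger0_norm// -sqrtr_sqr ler_sqrt ?exprn_ge0//.
by rewrite expr2 ler_peMl// ler1n.
Qed.

Lemma ler_sqrtS (R : realType) (k : nat) :
  Num.sqrt (k.+1%:R : R) <= Num.sqrt k%:R + 1.
Proof.
have s0 : 0 <= Num.sqrt (k%:R : R) by exact: sqrtr_ge0.
rewrite -[leRHS]ger0_norm ?addr_ge0// -sqrtr_sqr ler_sqrt ?sqr_ge0//.
rewrite sqrrD sqr_sqrtr// mulr1 expr1n -natr1; lra.
Qed.

Section digit_count_theory.
Variables (R : realType) (alpha : R).
Hypothesis alpha01 : 0 <= alpha <= 1.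
Local Notation n := (digit_count alpha).

Let arg_ge0 k : 0 <= alpha * (k%:R - Num.sqrt k%:R).
Proof.
by case/andP: alpha01 => a0 _; rewrite mulr_ge0// subr_ge0 ler_sqrt_nat.
Qed.

Lemma digit_count0 : n 0 = 0%N.
Proof. by rewrite /digit_count sqrtr0 subrr mulr0 truncn0. Qed.

(** Since [0 <= sqrt (k+1) - sqrt k <= 1], the real number under the floor does not decrease and
    grows by at most [alpha <= 1] per step. *)
Lemma digit_countS k : n k.+1 = n k \/ n k.+1 = (n k).+1.
Proof.
case/andP: alpha01 => a0 a1.
have s0 := sqrtr_ge0 (k%:R : R); have sS := ler_sqrtS R k.
have sm : Num.sqrt (k%:R : R) <= Num.sqrt k.+1%:R by rewrite ler_sqrt// ler_nat.
have le1 : (n k <= n k.+1)%N.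
  by apply: le_truncn; rewrite ler_wpM2l//; move: (natr1 k : _ = _ :> R); lra.
have le2 : (n k.+1 < (n k).+2)%N.
  rewrite truncn_lt_nat//.
  have /andP[_] := truncn_itv (arg_ge0 k); rewrite -[(_.+2)%:R]natr1.
  rewrite -/(n k); set t := _%:R => h.
  apply: (@le_lt_trans _ _ (alpha * (k%:R - Num.sqrt k%:R) + 1)); last by lra.
  have : alpha * (k.+1%:R - Num.sqrt k.+1%:R) <=
    alpha * (k%:R - Num.sqrt k%:R) + alpha * 1.
    by rewrite -mulrDr ler_wpM2l//; move: (natr1 k : _ = _ :> R); lra.
  lra.
lia.
Qed.

(** If every step from [k] on consumed digits, [n] would grow with slope 1 there, and the deficit
    [sqrt k] below the diagonal could not build up. *)
Lemma digit_count_flat k : exists2 j, (k <= j)%N & n j.+1 = n j.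
Proof.
apply: contrapT => nflat.
have step j : (k <= j)%N -> n j.+1 = (n j).+1.
  by move=> kj; case: (digit_countS j) => // e; case: nflat; exists j.
have grow i : (i <= n (k + i))%N.
  elim: i => // i IH; rewrite addnS step ?leq_addr//.
(* A perfect square with root [k+1]: growth from [k] on gives [N - k <= n N], whereas the definition
   gives [n N <= N - (k+1)]. *)
pose N := ((k.+1) ^ 2)%N.
have kN : (k <= N)%N by rewrite /N; nia.
have := grow (N - k)%N; rewrite subnKC// truncn_ge_nat//.
have -> : Num.sqrt (N%:R : R) = k.+1%:R by rewrite natrX sqrtr_sqr ger0_norm.
rewrite natrB// => le1.
case/andP: alpha01 => a0 a1.
have : alpha * (N%:R - k.+1%:R) <= 1 * (N%:R - k.+1%:R).
  by rewrite ler_wpM2r// subr_ge0 ler_nat /N; nia.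
rewrite -[k.+1%:R]natr1; lra.
Qed.

Lemma cvg_digit_count : (n k)%:R / k%:R @[k --> \oo] --> alpha.
Proof.
case/andP: alpha01 => a0 a1.
apply/cvgrPdist_le => e e0; near=> k.
have k0 : 0 < (k%:R : R) by rewrite ltr0n; near: k; exact: nbhs_infty_gt.
(* The error [alpha * k - n k] lies between 0 and [alpha * sqrt k + 1], hence is at most
   [2 * sqrt k]; this threshold on [k] makes it at most [e * k]. *)
have kbig : 4 / e ^+ 2 <= k%:R by near: k; exact: nbhs_infty_ger.
have /andP[l1 l2] := truncn_itv (arg_ge0 k).
rewrite -/(n k) in l1 l2.
have sk : Num.sqrt (k%:R : R) * Num.sqrt k%:R = k%:R.
  by rewrite -expr2 sqr_sqrtr.
set s := Num.sqrt (k%:R : R) in l1 l2 sk *.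
have s1 : 1 <= s by rewrite -[1]sqrtr1 ler_sqrt// ler1n -(ltr0n R).
have es : 2 <= e * s.
  rewrite -(@ler_pXn2r _ 2)// ?nnegrE ?mulr_ge0 ?(ltW e0)//; last by lra.
  rewrite exprMn [s ^+ 2]expr2 sk.
  move: kbig; rewrite ler_pdivrMr ?exprn_gt0//; lra.
have -> : alpha - (n k)%:R / k%:R = (alpha * k%:R - (n k)%:R) / k%:R.
  by rewrite mulrBl mulfK// gt_eqF.
rewrite normrM normfV [`|k%:R|]gtr0_norm// ler_pdivrMr//.
have as0 : alpha * s <= s by rewrite ler_piMl//; lra.
have as1 : 0 <= alpha * s by rewrite mulr_ge0//; lra.
have ek : 2 * s <= e * k%:R by rewrite -sk mulrA ler_wpM2r//; lra.
move: l1 l2; rewrite mulrBr -natr1 => l1 l2.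
by rewrite ler_norml; apply/andP; split; lra.
Unshelve. all: by end_near.
Qed.

End digit_count_theory.

(* Infinitely many zero digits make the upper bound strict. *)
Lemma dyadic_expansion (R : realType) (c : nat -> int) (e : nat -> bool) :
  (forall k, c k.+1 = 2 * c k + (e k : nat)%:Z) ->
  (forall k, exists2 j, (k <= j)%N & ~~ e j) ->
  forall k, (c k)%:~R * 2 ^- k <=
    sup (range (fun i => (c i)%:~R * 2 ^- i : R)) < (c k + 1)%:~R * 2 ^- k.
Proof.
move=> cS e0.
pose lo i : R := (c i)%:~R * 2 ^- i.
pose hi i : R := (c i + 1)%:~R * 2 ^- i.
have half k : (2 : R) ^- k = 2 * 2 ^- k.+1.
  by rewrite exprS invfM mulrA divff// mul1r.
have pos k : 0 < (2 : R) ^- k by rewrite invr_gt0 exprn_gt0.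
have loS k : lo k <= lo k.+1.
  rewrite /lo cS (half k) mulrA ler_pM2r// intrD intrM.
  by rewrite -[in leLHS]mulrC lerDl ler0n.
have hiS k : hi k.+1 <= hi k.
  rewrite /hi cS (half k) [leRHS]mulrA ler_pM2r// !intrD intrM.
  by case: (e k) => /=; lra.
have hiS' k : ~~ e k -> hi k.+1 < hi k.
  move=> /negbTE ek; rewrite /hi cS ek (half k) [ltRHS]mulrA ltr_pM2r//.
  rewrite !intrD intrM /=; lra.
have lohi k : lo k <= hi k by rewrite /lo /hi ler_pM2r// intrD; lra.
have lom i j : (i <= j)%N -> lo i <= lo j.
  exact: (homo_leq (@lexx _ _) (@le_trans _ _) loS).
have him i j : (i <= j)%N -> hi j <= hi i.
  move=> ij; rewrite -lerN2; move: i j ij.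
  apply: (homo_leq (f := fun i => - hi i) (@lexx _ _) (@le_trans _ _)) => i.
  by rewrite lerN2.
have ub k : ubound (range lo) (hi k).
  move=> _ [i _ <-]; case: (leqP i k) => ik.
    exact: le_trans (lom _ _ ik) (lohi k).
  exact: le_trans (lohi i) (him _ _ (ltnW ik)).
have ne : range lo !=set0 by exists (lo 0%N), 0%N.
move=> k; apply/andP; split.
  by apply: ub_le_sup; [exists (hi 0%N); exact: ub | exists k].
have [j kj ej] := e0 k.
apply: (@le_lt_trans _ _ (hi j.+1)); first exact: ge_sup.
exact: lt_le_trans (hiS' _ ej) (him _ _ kj).
Qed.

(** * Binary digits of a uniform variable *)

Definition unit_clip (R : realType) (u : R) : R := if 0 <= u < 1 then u else 0.

(* The integer whose binary expansion is given by the first n binary digits of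
   u; the clipping only matters off [0, 1[. *)
Definition bits (R : realType) (n : nat) (u : R) : nat :=
  Num.truncn (2 ^+ n * unit_clip u).

Section bits_theory.
Variable R : realType.
Implicit Types (u v : R) (n a : nat).

(** Valid for every real [u], so the digit identities below carry no side condition on the second
    coordinate of the product space. *)
Lemma unit_clip_itv u : 0 <= unit_clip u < 1.
Proof. by rewrite /unit_clip; case: ifP => // _; rewrite lexx ltr01. Qed.

Let arg_ge0 n u : 0 <= 2 ^+ n * unit_clip u.
Proof. by have /andP[? _] := unit_clip_itv u; rewrite mulr_ge0. Qed.

Lemma bits_eq n u a :
  (bits n u == a) = (a%:R <= 2 ^+ n * unit_clip u < a.+1%:R).
Proof. by rewrite /bits truncn_eq. Qed.

Lemma bits0 u : bits 0 u = 0%N.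
Proof. by apply/eqP; rewrite bits_eq expr0 mul1r unit_clip_itv. Qed.

(** The floor of [y] is half the floor of [2 * y], rounded down; the parity that is lost is digit
    number [n+1] of [u]. *)
Lemma bitsS n u : bits n.+1 u = (odd (bits n.+1 u) + (bits n u).*2)%N.
Proof.
suff -> : bits n u = (bits n.+1 u)./2 by rewrite odd_double_half.
apply/eqP; rewrite bits_eq.
have /andP[] := truncn_itv (arg_ge0 n.+1 u).
rewrite -/(bits n.+1 u) exprS -mulrA.
set x := 2 ^+ n * _; set b := bits _ _.
have : (b./2.*2 <= b)%N && (b < (b./2.+1).*2)%N by lia.
rewrite -(ler_nat R) -(ler_nat R) -!muln2 !natrM -!natr1 => /andP[h1 h2] h3 h4.
by apply/andP; split; lra.
Qed.

Lemma ex_bits n a : (a < 2 ^ n)%N -> exists u, bits n u = a.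
Proof.
move=> an; exists (a%:R / 2 ^+ n); apply/eqP; rewrite bits_eq.
rewrite /unit_clip divr_ge0//= ltr_pdivrMr ?exprn_gt0// mul1r -natrX ltr_nat an.
by rewrite mulrC divfK ?gt_eqF ?ltr0n ?expn_gt0// lexx ltr_nat ltnS leqnn.
Qed.

Lemma measurable_unit_clip : measurable_fun [set: R] (@unit_clip R).
Proof.
rewrite /unit_clip; apply: measurable_fun_if => //=.
apply: measurable_and => //; first exact: measurable_fun_ler.
exact: measurable_fun_ltr.
Qed.

Lemma measurable_bits n a : measurable [set u : R | bits n u = a].
Proof.
have -> : [set u : R | bits n u = a] =
    [set: R] `&` (fun u => 2 ^+ n * unit_clip u) @^-1` `[a%:R, a.+1%:R[%classic.
  rewrite setTI; apply/seteqP; split => u /=; rewrite in_itv/= -bits_eq.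
    by move=> ->.
  by move/eqP.
apply: measurable_funM => //; exact: measurable_unit_clip.
Qed.

Lemma uniform_prob01E (A : set R) : measurable A ->
  uniform_prob (@ltr01 R) A = lebesgue_measure (A `&` `[0%R, 1%R]%classic).
Proof.
move=> mA; rewrite /uniform_prob integral_uniform_pdf.
rewrite (eq_integral (cst 1%E)).
  by rewrite integral_cst ?mul1e//; exact: measurableI.
move=> x; rewrite inE => -[_] /=; rewrite in_itv/= /uniform_pdf => ->.
by rewrite subr0 invr1.
Qed.

Lemma uniform_prob_bits_le n a :
  (uniform_prob (@ltr01 R) [set u : R | bits n u = a] <= (2 ^- n)%:E)%E.
Proof.
have n0 : 0 < (2 : R) ^+ n by rewrite exprn_gt0.
rewrite uniform_prob01E; [|exact: measurable_bits].
(* The point 1 is clipped to 0, so it falls in the fiber of [a = 0], outside the dyadic interval; it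
   has Lebesgue measure zero. *)
have sub : [set u : R | bits n u = a] `&` `[0, 1]%classic `<=`
    `[a%:R / 2 ^+ n, a.+1%:R / 2 ^+ n]%classic `|` [set 1%R].
  move=> u [/= /eqP]; rewrite bits_eq in_itv/= => /andP[h1 h2] /andP[u0 u1].
  move: u1; rewrite le_eqVlt => /orP[/eqP ->|u1]; first by right.
  left; rewrite /= in_itv/=; move: h1 h2; rewrite /unit_clip u0 u1/= => h1 h2.
  by rewrite ler_pdivrMr// ler_pdivlMr// mulrC h1 ltW.
apply: (@le_trans _ _ (lebesgue_measure
    (`[a%:R / 2 ^+ n, a.+1%:R / 2 ^+ n]%classic `|` [set 1%R]))).
  apply: le_measure; [| |exact: sub]; rewrite inE.
    by apply: measurableI => //; exact: measurable_bits.
  exact: measurableU.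
apply: (le_trans (measureU2 _ _ _)) => //.
rewrite /= -[leLHS]/(_ + lebesgue_measure [set 1%R])%E.
rewrite lebesgue_measure_set1 adde0.
rewrite -[leLHS]/(lebesgue_measure _) lebesgue_measure_itv/= lte_fin.
by rewrite ltr_pM2r ?invr_gt0// ltr_nat ltnSn -EFinD lee_fin -natr1; lra.
Qed.

Lemma uniform_prob_bits_ge n a : (a < 2 ^ n)%N ->
  ((2 ^- n)%:E <= uniform_prob (@ltr01 R) [set u : R | bits n u = a])%E.
Proof.
move=> an; have n0 : 0 < (2 : R) ^+ n by rewrite exprn_gt0.
rewrite uniform_prob01E; [|exact: measurable_bits].
have sub : `[a%:R / 2 ^+ n, a.+1%:R / 2 ^+ n[%classic `<=`
    [set u : R | bits n u = a] `&` `[0, 1]%classic.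
  move=> u /=; rewrite !in_itv/= => /andP[h1 h2].
  have u0 : 0 <= u by apply: le_trans h1; rewrite divr_ge0.
  have u1 : u < 1.
    apply: (lt_le_trans h2); rewrite ler_pdivrMr// mul1r -natrX ler_nat//.
  split; last by rewrite u0 ltW.
  apply/eqP; rewrite bits_eq /unit_clip u0 u1/= mulrC.
  by rewrite -ler_pdivrMr// -ltr_pdivlMr// h1.
apply: (@le_trans _ _ (lebesgue_measure
    `[a%:R / 2 ^+ n, a.+1%:R / 2 ^+ n[%classic)).
  rewrite lebesgue_measure_itv/= lte_fin.
  by rewrite ltr_pM2r ?invr_gt0// ltr_nat ltnSn -EFinD lee_fin -natr1; lra.
apply: le_measure; [| |exact: sub]; rewrite inE//.
by apply: measurableI => //; exact: measurable_bits.
Qed.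

End bits_theory.

Lemma bits_half (R : realType) n (u : R) : bits n u = (bits n.+1 u)./2.
Proof. by rewrite [bits n.+1 u]bitsS half_bit_double. Qed.

Lemma bits_prefix (R : realType) n k (u v : R) : (k <= n)%N ->
  bits n u = bits n v -> bits k u = bits k v.
Proof.
move=> /subnKC <-; elim: (n - k)%N => [|i IH]; first by rewrite addn0.
by rewrite addnS => e; apply: IH; rewrite bits_half e -bits_half.
Qed.

(** * Unions over countable types *)

Lemma bigcup_unpickle (C : countType) (T : Type) (F : C -> set T) :
  \bigcup_c F c = \bigcup_n oapp F set0 (choice.unpickle n).
Proof.
apply/seteqP; split => x [i _].
  by move=> Fx; exists (choice.pickle i) => //=; rewrite choice.pickleK.
by case: choice.unpickle => //= c Fx; exists c.
Qed.

Lemma countable_bigcup_measurable d (T : measurableType d) (C : countType)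
  (F : C -> set T) :
  (forall c, measurable (F c)) -> measurable (\bigcup_c F c).
Proof.
move=> mF; rewrite bigcup_unpickle; apply: bigcupT_measurable => n.
by case: choice.unpickle => [c|] /=; [exact: mF|exact: measurable0].
Qed.

(** Otherwise the whole space would be a countable union of null sets. This will provide a starting
    corner of positive mass. *)
Lemma countable_cover_gt0 d (T : measurableType d) (R : realType)
  (mu : {measure set T -> \bar R}) (C : countType) (F : C -> set T) :
  (forall c, measurable (F c)) -> \bigcup_c F c = setT -> (0 < mu setT)%E ->
  exists c, (0 < mu (F c))%E.
Proof.
move=> mF FT mu0; apply: contrapT => nex.
suff : mu.-negligible [set: T].
  by move/negligibleP => /(_ measurableT) e; rewrite e ltxx in mu0.
rewrite -FT bigcup_unpickle; apply: negligible_bigcup => n.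
case: choice.unpickle => [c|] /=; last exact: negligible_set0.
apply/negligibleP => //; apply/eqP; rewrite eq_le measure_ge0 andbT leNgt.
by apply/negP => h; apply: nex; exists c.
Qed.

(** * Euclidean norm, Lipschitz functions and dyadic cubes *)

Section euclidean.
Variables (R : realType) (m : nat).
Implicit Types (x y : 'rV[R]_m).

Lemma enorm_ge0 x : 0 <= enorm x.
Proof. exact: sqrtr_ge0. Qed.

Lemma normr_coord_le_enorm x i : `|x 0 i| <= enorm x.
Proof.
rewrite -sqrtr_sqr ler_sqrt; last by apply: sumr_ge0 => *; exact: sqr_ge0.
by rewrite (bigD1 i)//= lerDl sumr_ge0// => *; exact: sqr_ge0.
Qed.

(** The sharp factor is [sqrt m]; the cruder [m] follows from [m <= m ^ 2] and is enough for
    limits. *)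
Lemma enorm_le_natmul x (c : R) : 0 <= c -> (forall i, `|x 0 i| <= c) ->
  enorm x <= m%:R * c.
Proof.
move=> c0 xc.
have mc0 : 0 <= m%:R * c by rewrite mulr_ge0.
rewrite -[leRHS]ger0_norm// -sqrtr_sqr ler_sqrt ?sqr_ge0//.
apply: (@le_trans _ _ (\sum_(i < m) c ^+ 2)).
  apply: ler_sum => i _; rewrite -[x 0 i ^+ 2]ger0_norm ?sqr_ge0// normrX.
  by rewrite lerXn2r// nnegrE.
rewrite sumr_const card_ord exprMn -[leLHS]mulr_natl ler_wpM2r ?sqr_ge0//.
by rewrite -natrX ler_nat; nia.
Qed.

Lemma measurable_continuous_rV (f : 'rV[R]_m -> R) : continuous f ->
  measurable_fun [set: borelRV R m] (f : borelRV R m -> R).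
Proof.
move=> cf; apply: (measurability _ (RGenOInfty.measurableE R)).
move=> _ [_ [a ->] <-]; rewrite setTI; apply: sub_sigma_algebra.
by apply: open_comp => [x _|]; [exact: cf|exact: rray_open].
Qed.

Lemma measurable_coord i :
  measurable_fun [set: borelRV R m] ((fun x => x 0 i) : borelRV R m -> R).
Proof. by apply: measurable_continuous_rV; exact: coord_continuous. Qed.

Lemma measurable_enorm :
  measurable_fun [set: borelRV R m] (@enorm R m : borelRV R m -> R).
Proof.
apply: (measurableT_comp (f := @Num.sqrt R)).
  by apply: continuous_measurable_fun; exact: sqrt_continuous.
by apply: measurable_sum => i; apply: measurable_funX; exact: measurable_coord.
Qed.

Lemma Lip1_continuous (f : 'rV[R]_m -> R) : Lip1 f -> continuous f.
Proof.
move=> f1 x; apply/(@cvgrPdist_lt _ _ _ _ (nbhs_filter x)) => e e0.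
(* Neighbourhoods are balls of the sup norm, which costs a factor [m]; dividing by [m+1] makes the
   bound strict and covers [m = 0]. *)
pose d := e / m.+1%:R.
have d0 : 0 < d by rewrite divr_gt0.
apply/nbhs_ballP; exists d => //= y [_ /= xy].
apply: (le_lt_trans (f1 x y)).
apply: (@le_lt_trans _ _ (m%:R * d)).
  by apply: enorm_le_natmul => [|i]; [exact: ltW|rewrite !mxE; exact/ltW/xy].
by rewrite /d mulrCA gtr_pMr// ltr_pdivrMr// mul1r ltr_nat.
Qed.

Lemma Lip1_measurable (f : 'rV[R]_m -> R) : Lip1 f ->
  measurable_fun [set: borelRV R m] (f : borelRV R m -> R).
Proof. by move/Lip1_continuous/measurable_continuous_rV. Qed.

Lemma Lip1_le (f : 'rV[R]_m -> R) x : Lip1 f -> `|f x| <= `|f 0| + enorm x.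
Proof.
move=> /(_ x 0); rewrite subr0 -lerBlDl => h.
exact: le_trans (lerB_dist _ _) h.
Qed.

(** Finite functions, unlike plain functions, form a countable type here, which the countable unions
    of cubes rely on. *)
Definition cell k x : {ffun 'I_m -> int} :=
  [ffun l => Num.floor (2 ^+ k * x 0 l)].

Lemma dyadic_cubeE k (j : 'I_m -> int) x :
  dyadic_cube k j x <-> cell k x = [ffun l => j l].
Proof.
have pos : 0 < (2 : R) ^+ k by rewrite exprn_gt0.
split=> [xj|xj l].
  apply/ffunP => l; rewrite !ffunE; apply/eqP; rewrite floor_eq.
  by have := xj l; rewrite mulrC -ler_pdivrMl// -ltr_pdivlMl// ![_^-1 * _]mulrC.
move/ffunP : xj => /(_ l); rewrite !ffunE => /eqP; rewrite floor_eq.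
by rewrite mulrC -ler_pdivrMr// -ltr_pdivlMr//.
Qed.

Lemma dyadic_cube_dist k (j : 'I_m -> int) x y i :
  dyadic_cube k j x -> dyadic_cube k j y -> `|x 0 i - y 0 i| < 2 ^- k.
Proof.
move=> /(_ i)/andP[x1 x2] /(_ i)/andP[y1 y2].
move: x2 y2; rewrite !intrD !mulrDl !mul1r => x2 y2.
by rewrite ltr_norml; apply/andP; split; lra.
Qed.

(** A fine enough cube around a point fits into a given sup-norm ball. Only levels at least [s] are
    used, because the cubes of the constructed random point are described from level [s] on. *)
Lemma open_dyadicE s (U : set 'rV[R]_m) : open U ->
  U = \bigcup_(c : nat * {ffun 'I_m -> int})
    [set x | dyadic_cube (c.1 + s) c.2 x /\ dyadic_cube (c.1 + s) c.2 `<=` U].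
Proof.
move=> oU; apply/seteqP; split => [x Ux|x [c _ [xc]]]; last exact.
have /nbhs_ballP[e /= e0 eU] : nbhs x U by exact: open_nbhs_nbhs.
have [N _ /(_ _ (leq_addr s N)) /= Ne] :=
  near_infty_natSinv_expn_lt (PosNum e0).
exists (N, cell (N + s) x) => //=.
have xc : dyadic_cube (N + s) (cell (N + s) x) x.
  by apply/dyadic_cubeE/ffunP => l; rewrite !ffunE.
split=> // y yc; apply: eU; split=> // i l; rewrite ord1.
by apply: lt_trans (dyadic_cube_dist _ xc yc) _; rewrite -div1r.
Qed.

Lemma measurable_fun_dyadic d (T : measurableType d) s (X : T -> borelRV R m) :
  (forall k j, measurable (X @^-1` dyadic_cube (k + s) j)) ->
  measurable_fun setT X.
Proof.
move=> mX.
apply: (@measurability _ _ T (borelRV R m) setT X (@open 'rV[R]_m)) => //.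
move=> _ [U /= oU <-].
rewrite setTI (open_dyadicE s oU) preimage_bigcup.
apply: countable_bigcup_measurable => c.
have [cU|cU] := pselect (dyadic_cube (c.1 + s) c.2 `<=` U).
  rewrite (_ : _ @^-1` _ = X @^-1` dyadic_cube (c.1 + s) c.2)//.
  by apply/seteqP; split => x //= [].
by rewrite (_ : _ @^-1` _ = set0)//; apply/seteqP; split => x //= [].
Qed.

Lemma measurable_dyadic_cube k (j : 'I_m -> int) :
  measurable (dyadic_cube k j : set (borelRV R m)).
Proof.
rewrite (_ : dyadic_cube k j = \bigcap_(l in [set: 'I_m])
  ((fun x : borelRV R m => x 0 l) @^-1`
    `[(j l)%:~R * 2 ^- k, (j l + 1)%:~R * 2 ^- k[%classic)).
  apply: fin_bigcap_measurable => // l _.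
  by rewrite -[X in measurable X]setTI; apply: measurable_coord.
apply/seteqP; split => x xj l.
  by move=> _ /=; rewrite in_itv/=; exact: xj.
by have := xj l I; rewrite /= in_itv.
Qed.

End euclidean.

(** * Bounds on [L^q] sums and the resulting dimension *)

Section Lq_sum_bounds.
Variables (R : realType) (m : nat) (nu : probability (borelRV R m) R) (q : R).
Hypothesis q1 : 1 < q.

(** Each term satisfies [x ^ q <= M ^ (q - 1) * x], and the masses of the disjoint cubes of one
    level add up to at most 1. *)
Lemma Lq_sum_le k (M : R) :
  (forall j, (nu (@dyadic_cube R m k j) <= M%:E)%E) ->
  (Lq_sum nu q k <= (M `^ (q - 1))%:E)%E.
Proof.
move=> nuM; have q0 : 0 < q - 1 by rewrite subr_gt0.
apply: ge_ereal_sup => _ [X [finX Xcubes] <-].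
have mX (Q : set (borelRV R m)) : X Q -> measurable Q.
  by move=> /Xcubes[j _ <-]; exact: measurable_dyadic_cube.
have powle (x : \bar R) : (0 <= x)%E -> (x <= M%:E)%E ->
    (x `^ q <= (M `^ (q - 1))%:E * x)%E.
  case: x => [p| |]; [|by rewrite leye_eq|by rewrite leeNy_eq].
  rewrite !lee_fin => p0 pM.
  have -> : p `^ q = p `^ (q - 1) * p.
    have := @powRD _ p (q - 1) 1; rewrite subrK powRr1// => -> //.
    by rewrite gt_eqF//; lra.
  by rewrite ler_wpM2r// ge0_ler_powR ?nnegrE ?(ltW q0)//; exact: le_trans pM.
apply: (@le_trans _ _ (\sum_(Q \in X) (M `^ (q - 1))%:E * nu Q)%E).
  by apply: lee_fsum => // Q /Xcubes[j _ <-]; exact: powle.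
rewrite -ge0_mule_fsumr ?lee_fin ?powR_ge0//.
rewrite -[leRHS]mule1 lee_wpmul2l ?lee_fin ?powR_ge0//.
rewrite -(@measure_fin_bigcup _ _ _ nu _ X id)//.
  by apply: probability_le1; exact: fin_bigcup_measurable.
(* Disjointness: a common point has a single [cell], so two cubes of the same level that meet
   coincide. *)
move=> Q1 Q2 /Xcubes[j1 _ <-] /Xcubes[j2 _ <-].
move=> [x [/dyadic_cubeE x1 /dyadic_cubeE]]; rewrite x1.
move=> /ffunP j12; congr dyadic_cube; apply/funext => l.
by have := j12 l; rewrite !ffunE.
Qed.

(** All cubes except the [Q i] are dropped from the sum; injectivity makes the remaining terms [n]
    separate ones. *)
Lemma Lq_sum_ge k n (c : R) (Q : nat -> set (borelRV R m)) :
  0 <= c -> set_inj `I_n Q -> (forall i, (i < n)%N -> dyadic_cubes k (Q i)) ->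
  (forall i, (i < n)%N -> (c%:E <= nu (Q i))%E) ->
  ((n%:R * c `^ q)%:E <= Lq_sum nu q k)%E.
Proof.
move=> c0 Qinj Qcubes cQ; apply: esum_ge; exists (Q @` `I_n).
  by split; [exact: finite_image|move=> _ [i /Qcubes ? <-]].
rewrite fsbig_image// -fsbig_ord.
apply: (@le_trans _ _ (\sum_(i < n) (c `^ q)%:E)%E).
  by rewrite sumEFin sumr_const card_ord lee_fin mulr_natl.
apply: lee_sum => i _; rewrite -poweR_EFin.
apply: gt0_ler_poweR; [by move: q1; lra| | |exact: cQ].
  by rewrite in_itv/= leey lee_fin c0.
by rewrite in_itv/= leey measure_ge0.
Qed.

End Lq_sum_bounds.

(** Taking logarithms pins [- log2] of the sum to [(q - 1) * N k] up to a constant depending on [p]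
    and [q]. Neither this constant nor the shift by [s] survives division by [k + s] in the
    limit. *)
Lemma dimLq_of_bounds (R : realType) (m : nat)
    (nu : probability (borelRV R m) R) (q p beta : R) (s : nat)
    (N : nat -> nat) : 1 < q -> 0 < p ->
  (forall k, ((p `^ q * (2 ^- N k) `^ (q - 1))%:E <= Lq_sum nu q (k + s))%E /\
     (Lq_sum nu q (k + s) <= ((2 ^- N k) `^ (q - 1))%:E)%E) ->
  (N k)%:R / k%:R @[k --> \oo] --> beta ->
  dimLq nu q = beta%:E.
Proof.
move=> q1 p0 bounds cvgN.
have q10 : 0 < q - 1 by rewrite subr_gt0.
have ln20 : 0 < ln (2 : R) by rewrite ln_gt0// ltr1n.
pose u k : R := - log2 (fine (Lq_sum nu q k)) / k%:R.
pose A := - (q * log2 p).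
have ubounds k : (q - 1) * (N k)%:R <= - log2 (fine (Lq_sum nu q (k + s)))
    <= (q - 1) * (N k)%:R + A.
  have [] := bounds k; case: (Lq_sum _ _ _) => // S.
  rewrite !lee_fin /= => lo hi.
  have M0 : 0 < (2 : R) ^- N k by rewrite invr_gt0 exprn_gt0.
  have M1 : 0 < ((2 : R) ^- N k) `^ (q - 1) by rewrite powR_gt0.
  have P1 : 0 < p `^ q by rewrite powR_gt0.
  have S0 : 0 < S by apply: lt_le_trans lo; rewrite mulr_gt0.
  have lnMk : ln (((2 : R) ^- N k) `^ (q - 1)) = - ((q - 1) * (N k)%:R) * ln 2.
    by rewrite ln_powR lnV ?posrE ?exprn_gt0// lnXn// -mulr_natl; ring.
  rewrite /log2 -mulNr ler_pdivlMr// ler_pdivrMr//.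
  move: lo hi; rewrite -ler_ln ?posrE ?mulr_gt0// => lo.
  rewrite -ler_ln ?posrE// => hi.
  move: lo hi; rewrite lnM ?posrE// lnMk ln_powR => lo hi.
  have Aln : A * ln 2 = - (q * ln p) by rewrite /A /log2; field; rewrite gt_eqF.
  rewrite [(_ + A) * _]mulrDl Aln.
  by apply/andP; split; lra.
have inv0 : (k%:R^-1 : R) @[k --> \oo] --> (0 : R).
  rewrite -(cvg_shiftn 1) (_ : [sequence _]_n = harmonic).
    exact: cvg_harmonic.
  by apply/funext => k; rewrite /= addn1.
have invs0 : ((k + s)%:R^-1 : R) @[k --> \oo] --> (0 : R).
  by move: inv0; rewrite -(cvg_shiftn s).
(* For [k > 0] this is [(q - 1) * N k / (k + s)], written through [N k / k] so that its limit can be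
   read off. *)
pose lo k : R := (q - 1) * ((N k)%:R / k%:R * (1 - s%:R * (k + s)%:R^-1)).
have cvglo : lo k @[k --> \oo] --> (q - 1) * beta.
  have -> : (q - 1) * beta = (q - 1) * (beta * (1 - s%:R * 0)) by ring.
  apply: cvgM; first exact: cvg_cst.
  apply: cvgM => //; apply: cvgB; first exact: cvg_cst.
  by apply: cvgM => //; exact: cvg_cst.
have cvghi : lo k + A * (k + s)%:R^-1 @[k --> \oo] --> (q - 1) * beta.
  have -> : (q - 1) * beta = (q - 1) * beta + A * 0 by ring.
  by apply: cvgD => //; apply: cvgM => //; exact: cvg_cst.
have cvgu : u k @[k --> \oo] --> (q - 1) * beta.
  rewrite -(cvg_shiftn s) /=; apply: (squeeze_cvgr _ cvglo cvghi).
  near=> k.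
  have k0 : 0 < k%:R :> R by rewrite ltr0n; near: k; exact: nbhs_infty_gt.
  have ks0 : 0 < (k + s)%:R :> R by rewrite natrD ltr_wpDr.
  have -> : lo k = (q - 1) * (N k)%:R / (k + s)%:R.
    by rewrite /lo natrD; field; rewrite -natrD !gt_eqF.
  by rewrite /u -mulrDl !ler_pM2r ?invr_gt0.
rewrite /dimLq /tau.
have -> : limn_einf (fun k => (u k)%:E) = ((q - 1) * beta)%:E.
  have /cvg_limn_einf_sup[-> _//] :
    (u k)%:E @[k --> \oo] --> ((q - 1) * beta)%:E.
  by apply: cvg_EFin; [exact: nearW|exact: cvgu].
by rewrite -EFinM mulrAC divff ?mul1r// gt_eqF.
Unshelve. all: by end_near.
Qed.

(** * Couplings and the distance [dL] *)

Section coupling.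
Context d (T : measurableType d) (R : realType) (m : nat).
Variable P : probability T R.
Implicit Types X Y : {mfun T >-> borelRV R m}.

Lemma measurable_enormB X Y :
  measurable_fun setT (fun t => enorm ((X t : 'rV[R]_m) - Y t)).
Proof.
apply: (measurableT_comp (f := @Num.sqrt R)).
  by apply: continuous_measurable_fun; exact: sqrt_continuous.
apply: measurable_sum => i; apply: measurable_funX.
rewrite (_ : (fun _ => _) = (fun t => (X t : 'rV_m) 0 i - (Y t : 'rV_m) 0 i)).
  have mcoord (Z : {mfun T >-> borelRV R m}) :
      measurable_fun setT (fun t => (Z t : 'rV_m) 0 i).
    exact: (measurableT_comp (measurable_coord i) (measurable_funP Z)).
  by apply: measurable_funB; exact: mcoord.
by apply/funext => t; rewrite !mxE.
Qed.

Lemma integrable_enorm X : (\int[P]_t (enorm (X t))%:E < +oo)%E ->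
  P.-integrable setT (fun t => (enorm (X t))%:E).
Proof.
move=> X1; apply/integrableP; split.
  apply/measurable_EFinP; apply: measurableT_comp => //.
  exact: measurable_enorm.
by under eq_integral do rewrite gee0_abs ?lee_fin ?enorm_ge0//.
Qed.

Lemma Lip1_integrable X (f : 'rV[R]_m -> R) : Lip1 f ->
  (\int[P]_t (enorm (X t))%:E < +oo)%E ->
  P.-integrable setT (fun t => (f (X t))%:E).
Proof.
move=> f1 X1.
apply: (@le_integrable _ _ _ _ _ _ _
  (fun t => (`|f 0|%:E + (enorm (X t))%:E)%E)) => //.
- apply/measurable_EFinP; apply: measurableT_comp => //.
  exact: Lip1_measurable.
- move=> t _; rewrite -EFinD !abse_EFin lee_fin.
  by apply: le_trans (Lip1_le _ f1) _; exact: ler_norm.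
- apply: integrableD => //; last exact: integrable_enorm.
  exact: finite_measure_integrable_cst.
Qed.

(** The easy half of Kantorovich duality: for each [f] in [Lip1], the two integrals differ by at
    most the mean of [|f X - f Y|], which the cost dominates. Both first moments are finite, so the
    integrals may be subtracted. *)
Lemma dL_le_coupling (mu : probability (borelRV R m) R) X Y :
  (forall A, measurable A -> mu A = distribution P X A) ->
  (\int[P]_t (enorm (X t))%:E < +oo)%E ->
  (\int[P]_t (enorm (Y t))%:E < +oo)%E ->
  (dL mu (distribution P Y) <= \int[P]_t (enorm ((X t : 'rV[R]_m) - Y t))%:E)%E.
Proof.
move=> muX X1 Y1; apply: ge_ereal_sup => _ [f f1 <-].
have iX := Lip1_integrable f1 X1; have iY := Lip1_integrable f1 Y1.
have mf : measurable_fun setT (fun x : borelRV R m => (f x)%:E).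
  by apply/measurable_EFinP; exact: Lip1_measurable.
rewrite (@eq_measure_integral _ _ _ _ (distribution P X))//; last first.
  by move=> A mA _; exact: muX.
rewrite !integral_pushforward// preimage_setT -integralB//.
apply: (le_trans (le_abse_integral _ _ _)) => //.
  by have /integrableP[] := integrableB measurableT iX iY.
apply: ge0_le_integral => //.
- apply/measurableT_comp => //.
  by have /integrableP[] := integrableB measurableT iX iY.
- by apply/measurable_EFinP; exact: measurable_enormB.
- by move=> t _; rewrite -EFinB abse_EFin lee_fin; exact: f1.
Qed.

(** Dominated convergence with majorant [m * (enorm X + 1)]. At a fixed [t], every large [s] exceeds
    [enorm (X t)], and from then on the distance is at most [m * 2 ^- s]. *)
Lemma cvg_integral_enormB X (Y : nat -> {mfun T >-> borelRV R m}) :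
  (\int[P]_t (enorm (X t))%:E < +oo)%E ->
  (forall s t i, enorm (X t) < s%:R ->
     `|(X t : 'rV[R]_m) 0 i - (Y s t : 'rV[R]_m) 0 i| <= 2 ^- s) ->
  (forall s t i,
     `|(X t : 'rV[R]_m) 0 i - (Y s t : 'rV[R]_m) 0 i| <= enorm (X t) + 1) ->
  (\int[P]_t (enorm ((X t : 'rV[R]_m) - Y s t))%:E @[s --> \oo] --> 0)%E.
Proof.
move=> X1 near_XY XY.
have iX := integrable_enorm X1.
have [] := @dominated_convergence _ _ _ P _ measurableT
  (fun s t => (enorm ((X t : 'rV[R]_m) - Y s t))%:E) (cst 0%E)
  (fun t => m%:R%:E * ((enorm (X t))%:E + 1%:E))%E.
- by move=> s; apply/measurable_EFinP; exact: measurable_enormB.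
- exact: measurable_cst.
- apply: aeW => t _; apply: cvg_EFin; first exact: nearW.
  rewrite /comp/=.
  have lim0 : m%:R * (2 ^- s : R) @[s --> \oo] --> m%:R * (0 : R).
    apply: cvgM; first exact: cvg_cst.
    rewrite (_ : (fun s => _) = GRing.exp 2^-1).
      by apply: cvg_expr; rewrite gtr0_norm ?invr_gt0// invf_lt1// ltr1n.
    by apply/funext => s; rewrite exprVn.
  rewrite mulr0 in lim0.
  apply: (squeeze_cvgr _ (cvg_cst 0) lim0); near=> s.
  rewrite enorm_ge0/=; apply: enorm_le_natmul => // i; rewrite !mxE.
  apply: near_XY; near: s; exact: nbhs_infty_gtr.
- apply: integrableZl => //; apply: integrableD => //.
  exact: finite_measure_integrable_cst.
- apply: aeW => t s _; rewrite abse_EFin -EFinD -EFinM lee_fin.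
  rewrite ger0_norm ?enorm_ge0//.
  apply: enorm_le_natmul; first by rewrite addr_ge0 ?enorm_ge0.
  by move=> i; rewrite !mxE.
move=> _ _; rewrite integral0; exact.
Unshelve. all: by end_near.
Qed.

End coupling.

(** * Spreading a point with random digits *)

Section construction.
Variables (R : realType) (m : nat) (alpha : R) (s : nat).
Hypothesis alpha01 : 0 <= alpha <= 1.
Local Notation n := (digit_count alpha).
Local Notation Omega := (borelRV R m * measurableTypeR R)%type.
Implicit Types (x : 'rV[R]_m) (u : R) (w : 'rV[R]_m * R).

(** When step [k] consumes digits, coordinate [l] receives digit number [m * n k + l + 1] of [u], so
    one step uses a block of [m] consecutive digits; otherwise the digit is 0. *)
Definition digit k (l : nat) u : bool :=
  (n k.+1 != n k) && odd (bits (m * n k + l).+1 u).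

Definition start x : {ffun 'I_m -> int} :=
  if enorm x < s%:R then cell s x else [ffun=> 0].

Fixpoint spread_cell k w : {ffun 'I_m -> int} :=
  if k is k'.+1
  then [ffun l => 2 * spread_cell k' w l + (digit k' l w.2 : nat)%:Z]
  else start w.1.

(* By cell_spread, spread_cell k w is the index of the dyadic cube of level
   k + s that contains spread w. *)
Definition spread w : 'rV[R]_m :=
  \row_l (2 ^- s * sup (range (fun k => (spread_cell k w l)%:~R * 2 ^- k : R))).

(** Apply [dyadic_expansion] in each coordinate: a step at which [n] stays constant appends a zero,
    and [digit_count_flat] gives infinitely many of them. *)
Lemma cell_spread k w : cell (k + s) (spread w) = spread_cell k w.
Proof.
apply/ffunP => l; rewrite !ffunE mxE; apply/eqP; rewrite floor_eq.
have := @dyadic_expansion R (fun k => spread_cell k w l)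
  (fun k => digit k l w.2) _ _ k.
set y := sup _; rewrite exprD mulrA mulfK ?gt_eqF ?exprn_gt0//.
rewrite ler_pdivrMr ?exprn_gt0// ltr_pdivlMr ?exprn_gt0// mulrC; apply.
  by move=> i /=; rewrite ffunE.
move=> i; have [j ij nj] := digit_count_flat alpha01 i.
by exists j => //; rewrite /digit nj eqxx.
Qed.

Lemma dyadic_cube_spread k (j : 'I_m -> int) w :
  dyadic_cube (k + s) j (spread w) <-> spread_cell k w = [ffun l => j l].
Proof. by rewrite -cell_spread; exact: dyadic_cubeE. Qed.

(** The map sending [(c, e)] to [2 * c + e] is injective for a binary digit [e], so a cell remembers
    its start and all digits consumed. Hence the fibers of [spread_cell k] are product sets, whose
    mass factors. *)
Lemma spread_cell_eq k w w' :
  spread_cell k w = spread_cell k w' <->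
  start w.1 = start w'.1 /\ bits (m * n k) w.2 = bits (m * n k) w'.2.
Proof.
elim: k => [|k IH] /=.
  by rewrite digit_count0 muln0 !bits0; split=> [|[]].
have mono : (m * n k <= m * n k.+1)%N.
  by rewrite leq_mul2l; case: (digit_countS alpha01 k) => ->;
    rewrite ?leqnn ?leqnSn orbT.
split=> [/ffunP e|[e1 e2]]; last first.
  have ek : spread_cell k w = spread_cell k w'.
    by apply/IH; split=> //; exact: bits_prefix e2.
  apply/ffunP => l; rewrite !ffunE ek /digit.
  case: (digit_countS alpha01 k) => nk; first by rewrite nk eqxx.
  (* The digit read lies among the first [m * n k.+1], since [m * n k + l + 1 <= m * (n k + 1)] for
     [l < m]. *)
  rewrite (bits_prefix _ e2)// nk mulnS addnC -addSn leq_add2r; exact: ltn_ord.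
have ek l : spread_cell k w l = spread_cell k w' l /\
    digit k l w.2 = digit k l w'.2.
  by have := e l; rewrite !ffunE; case: digit; case: digit => /=; lia.
have [-> eN] : start w.1 = start w'.1 /\
    bits (m * n k) w.2 = bits (m * n k) w'.2.
  by apply/IH/ffunP => l; have [] := ek l.
split=> //; case: (digit_countS alpha01 k) => nk; first by rewrite nk.
rewrite nk mulnS addnC.
(* The block of [m] new digits is recovered one coordinate at a time. *)
suff H i : (i <= m)%N ->
  bits (m * n k + i) w.2 = bits (m * n k + i) w'.2 by exact: H.
elim: i => [|i IHi] im; first by rewrite addn0.
rewrite addnS bitsS IHi 1?ltnW// [RHS]bitsS; congr (nat_of_bool _ + _)%N.
have [_] := ek (Ordinal im).
by rewrite /digit nk (gtn_eqF (ltnSn _)).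
Qed.

Lemma measurable_start a : measurable [set x : borelRV R m | start x = a].
Proof.
have mball : measurable [set x : borelRV R m | enorm x < s%:R].
  rewrite (_ : [set _ | _] = setT `&` (@enorm R m) @^-1` `]-oo, s%:R[%classic).
    by apply: measurable_enorm.
  by rewrite setTI; apply/seteqP; split => x /=; rewrite in_itv.
have mcell : measurable [set x : borelRV R m | cell s x = a].
  rewrite (_ : [set _ | _] = dyadic_cube s a).
    exact: measurable_dyadic_cube.
  apply/seteqP; split => x /=; rewrite dyadic_cubeE => ->.
    by apply/ffunP => l; rewrite ffunE.
  by apply/ffunP => l; rewrite ffunE.
rewrite (_ : [set _ | _] =
  ([set x | enorm x < s%:R] `&` [set x | cell s x = a]) `|`
  (~` [set x | enorm x < s%:R] `&` [set _ : borelRV R m | [ffun=> 0] = a])).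
  apply: measurableU; apply: measurableI => //; first exact: measurableC.
  have [e|e] := pselect ([ffun=> 0] = a).
    by rewrite (_ : [set _ | _] = setT)//; apply/seteqP; split.
  by rewrite (_ : [set _ | _] = set0)//; apply/seteqP; split.
apply/seteqP; split => x /=; rewrite /start.
  by case: ifP => [|/negP] ? ?; [left|right].
by move=> [[-> //]|[/negP/negbTE -> //]].
Qed.

Lemma fiber_spread_cellE k w :
  [set w' : Omega | spread_cell k w' = spread_cell k w] =
  [set x | start x = start w.1] `*`
  [set u | bits (m * n k) u = bits (m * n k) w.2].
Proof. by apply/seteqP; split => -[x u] /=; rewrite spread_cell_eq. Qed.

Lemma measurable_fiber_spread_cell k w :
  measurable [set w' : Omega | spread_cell k w' = spread_cell k w].
Proof.
rewrite fiber_spread_cellE; apply: measurableX; first exact: measurable_start.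
exact: measurable_bits.
Qed.

Lemma measurable_spread :
  measurable_fun [set: Omega] (spread : _ -> borelRV R m).
Proof.
apply: (@measurable_fun_dyadic _ _ _ _ s) => k j.
have [[w jw]|nex] := pselect (exists w, spread_cell k w = [ffun l => j l]).
  rewrite (_ : _ @^-1` _ = [set w' | spread_cell k w' = spread_cell k w]).
    exact: measurable_fiber_spread_cell.
  by apply/seteqP; split => w' /=; rewrite dyadic_cube_spread jw.
rewrite (_ : _ @^-1` _ = set0); first exact: measurable0.
apply/seteqP; split => // w' /=; rewrite dyadic_cube_spread => e.
by apply: nex; exists w'.
Qed.

(** Refining the corner never leaves its cube, so both points lie in the same cube of level [s]. *)
Lemma spread_near x u i :
  enorm x < s%:R -> `|x 0 i - spread (x, u) 0 i| <= 2 ^- s.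
Proof.
move=> xs; apply/ltW/(@dyadic_cube_dist _ _ _ (cell s x)).
  by apply/dyadic_cubeE/ffunP => l; rewrite !ffunE.
apply/(@dyadic_cube_spread 0).
by rewrite /= /start xs; apply/ffunP => l; rewrite !ffunE.
Qed.

Lemma spread_far x u i :
  ~~ (enorm x < s%:R) -> 0 <= spread (x, u) 0 i <= 2 ^- s.
Proof.
move=> /negbTE xs.
have : dyadic_cube (0 + s) (fun=> 0) (spread (x, u)).
  by apply/dyadic_cube_spread; rewrite /= /start xs.
by move=> /(_ i)/andP[]; rewrite !add0n mul0r mul1r => -> /ltW.
Qed.

Let pow_le1 : 2 ^- s <= 1 :> R.
Proof. by rewrite invf_le1 ?exprn_gt0// exprn_ege1// ler1n. Qed.

Lemma spread_dist x u i : `|x 0 i - spread (x, u) 0 i| <= enorm x + 1.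
Proof.
have x0 := enorm_ge0 x; have := pow_le1.
have [xs|xs] := boolP (enorm x < s%:R).
  by have := spread_near u i xs; lra.
have /andP[y0 y1] := spread_far u i xs => p1.
apply: le_trans (ler_normB _ _) _.
apply: lerD; first exact: normr_coord_le_enorm.
by rewrite ger0_norm//; lra.
Qed.

Lemma spread_bounded w i : `|spread w 0 i| <= s%:R + 1.
Proof.
case: w => x u; have s0 : 0 <= s%:R :> R by []; have := pow_le1.
have [xs|xs] := boolP (enorm x < s%:R) => p1.
  have := spread_near u i xs; have := normr_coord_le_enorm x i.
  by rewrite !ler_norml => /andP[? ?] /andP[? ?]; apply/andP; split; lra.
have /andP[y0 y1] := spread_far u i xs.
by rewrite ger0_norm//; lra.
Qed.

End construction.

(** * Bounded support and the approximating measures *)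

Lemma supp_bounded (R : realType) (m : nat) (nu : probability (borelRV R m) R)
  (c : R) :
  0 <= c -> (forall i, nu [set x | c < `|x 0 i|] = 0%E) ->
  bounded_set (supp nu).
Proof.
move=> c0 nu0; exists c; split=> [|M cM x xs]; first by rewrite num_real.
change (mx_norm x <= M); rewrite mx_normrE.
apply: bigmax_le; first exact: le_trans c0 (ltW cM).
move=> [j i] _ /=; rewrite ord1 {j}; apply: le_trans (ltW cM).
rewrite leNgt; apply/negP => xi.
(* The norm is the sup norm, so a point too far out has one large coordinate; this open null
   neighbourhood then excludes it from the support. *)
have U_open : open [set y : 'rV[R]_m | c < `|y 0 i|].
  apply: (open_comp (f := fun y : 'rV[R]_m => `|y 0 i|) (D := [set r | c < r])).
    move=> y _; apply: (continuous_comp (@coord_continuous _ _ _ 0 i y)).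
    exact: norm_continuous.
  exact: open_gt.
by have := xs _ U_open xi; rewrite nu0 ltxx.
Qed.

Section approximation.
Variables (R : realType) (m : nat) (q beta : R).
Hypotheses (m_gt0 : (0 < m)%N) (q1 : 1 < q) (betam : 0 <= beta <= m%:R).
Variable mu : probability (borelRV R m) R.

Local Notation alpha := (beta / m%:R).
Local Notation n := (digit_count alpha).
Local Notation Omega := (borelRV R m * measurableTypeR R)%type.
Local Notation P := (mu \x uniform_prob (@ltr01 R))%E.

Let alpha01 : 0 <= alpha <= 1.
Proof.
case/andP: betam => b0 bm.
by rewrite divr_ge0//= ler_pdivrMr ?ltr0n// mul1r.
Qed.

Definition first_marginal : {mfun Omega >-> borelRV R m} :=
  HB.pack (@fst (borelRV R m) (measurableTypeR R))
    (isMeasurableFun.Build _ _ _ _ _ measurable_fst).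

Definition spread_mfun s : {mfun Omega >-> borelRV R m} :=
  HB.pack (spread alpha s : Omega -> borelRV R m)
    (isMeasurableFun.Build _ _ _ _ _ (measurable_spread s alpha01)).

Definition approx s : probability (borelRV R m) R :=
  distribution P (spread_mfun s).

Lemma approxE s A : approx s A = P (spread alpha s @^-1` A).
Proof. by []. Qed.

Lemma approx_bounded_supp s : bounded_set (supp (approx s)).
Proof.
apply: (@supp_bounded _ _ _ (s%:R + 1)) => // i.
rewrite approxE (_ : _ @^-1` _ = set0) ?measure0//.
apply/seteqP; split => // w /=.
by rewrite ltNge spread_bounded.
Qed.

Lemma approx_moment s : (\int[P]_w (enorm (spread_mfun s w))%:E < +oo)%E.
Proof.
apply: (@le_lt_trans _ _ (\int[P]_w (m%:R * (s%:R + 1))%:E)%E).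
  apply: ge0_le_integral => //.
  - by move=> w _; rewrite lee_fin enorm_ge0.
  - apply/measurable_EFinP; apply: (measurableT_comp (@measurable_enorm R m)).
    exact: measurable_spread.
  - move=> w _; rewrite lee_fin; apply: enorm_le_natmul => // i.
    exact: spread_bounded.
rewrite integral_cst// -[X in (_ * X)%E]/(P setT).
by rewrite probability_setT mule1 ltry.
Qed.

Lemma approx_PR s : PR (approx s).
Proof.
rewrite /PR /= ge0_integral_pushforward//; first exact: approx_moment.
  by apply/measurable_EFinP; exact: measurable_enorm.
by move=> x _; rewrite lee_fin enorm_ge0.
Qed.

Lemma first_marginalE (A : set (borelRV R m)) : measurable A ->
  mu A = distribution P first_marginal A.
Proof.
move=> mA; rewrite /distribution /pushforward /=.
rewrite (_ : _ @^-1` _ = A `*` setT).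
  rewrite product_measure1E//.
  by rewrite [X in (_ * X)%E]
    (@probability_setT _ _ _ (uniform_prob (@ltr01 R))) mule1.
by apply/seteqP; split => -[x u] //= [].
Qed.

Lemma approx_fiber s k w :
  approx s [set x | cell (k + s) x = spread_cell alpha s k w] =
  (mu [set x | start s x = start s w.1] *
   uniform_prob (@ltr01 R) [set u | bits (m * n k) u = bits (m * n k) w.2])%E.
Proof.
rewrite approxE (_ : _ @^-1` _ =
  [set w' | spread_cell alpha s k w' = spread_cell alpha s k w]).
  rewrite fiber_spread_cellE//= product_measure1E//.
    exact: measurable_start.
  exact: measurable_bits.
by apply/seteqP; split => w' /=; rewrite cell_spread.
Qed.

(** The starting corner contributes a factor at most 1 and the prescribed digits at most
    [2 ^- (m * n k)]; a cube whose index is never attained has mass 0. *)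
Lemma approx_dyadic_cube_le s k (j : 'I_m -> int) :
  (approx s (dyadic_cube (k + s) j) <= (2 ^- (m * n k))%:E)%E.
Proof.
have [[w jw]|nex] :=
  pselect (exists w, spread_cell alpha s k w = [ffun l => j l]).
  rewrite (_ : dyadic_cube _ _ =
    [set x | cell (k + s) x = spread_cell alpha s k w]).
    rewrite approx_fiber -[leRHS]mul1e; apply: lee_pmul => //.
      by apply: probability_le1; exact: measurable_start.
    exact: uniform_prob_bits_le.
  by apply/seteqP; split => x /=; rewrite dyadic_cubeE jw.
rewrite approxE (_ : _ @^-1` _ = set0) ?measure0 ?lee_fin//.
apply/seteqP; split => // w' /=; rewrite dyadic_cube_spread// => e.
by apply: nex; exists w'.
Qed.

Lemma approx_Lq_sum_ge s k a (p : R) : 0 < p ->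
  (p%:E <= mu [set x | start s x = a])%E ->
  ((p `^ q * (2 ^- (m * n k)) `^ (q - 1))%:E <= Lq_sum (approx s) q (k + s))%E.
Proof.
move=> p0 pa; set N := (m * n k)%N.
have [x0 x0a] : exists x0 : 'rV[R]_m, start s x0 = a.
  apply: contrapT => nex; move: pa.
  rewrite (_ : [set _ | _] = set0) ?measure0 ?lee_fin ?leNgt ?p0//.
  by apply/seteqP; split => // x /= xa; apply: nex; exists x.
(* One [u i] for each of the [2 ^ N] possible strings of the first [N] digits; with [x0] fixed, they
   select [2 ^ N] cubes. *)
have /choice[u uN] : forall i, exists u : R, (i < 2 ^ N)%N -> bits N u = i.
  by move=> i; have [/(@ex_bits R)[u ?]|] := ltnP i (2 ^ N);
    [exists u|exists 0].
pose Q i : set (borelRV R m) :=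
  dyadic_cube (k + s) (spread_cell alpha s k (x0, u i)).
have QE i : Q i = [set x | cell (k + s) x = spread_cell alpha s k (x0, u i)].
  by apply/seteqP; split => x; rewrite /Q /= dyadic_cubeE => ->;
    apply/ffunP => l; rewrite ffunE.
have two_gt0 : 0 < (2 : R) ^+ N by rewrite exprn_gt0.
(* The target is the number of selected cubes times the [q]-th power of the least mass [p * 2 ^- N]
   of each. *)
have -> : p `^ q * (2 ^- N) `^ (q - 1) = (2 ^ N)%:R * (p * 2 ^- N) `^ q.
  rewrite powRM ?ltW ?invr_gt0// mulrCA; congr (_ * _).
  have := @powRD _ (2 ^- N) (q - 1) 1.
  rewrite subrK powRr1 ?ltW ?invr_gt0// => ->.
    by rewrite natrX mulrCA mulfV ?mulr1// gt_eqF.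
  by apply/implyP => _; rewrite gt_eqF// invr_gt0.
apply: (@Lq_sum_ge _ _ _ _ q1 _ (2 ^ N)%N _ Q) => //.
- by rewrite mulr_ge0 ?ltW ?invr_gt0.
(* If [Q i = Q j], the point built from [u i] lies in [Q j], so its first [N] digits are those of
   [u j] and [i = j]. *)
- move=> i j; rewrite !inE /= => iN jN Qij.
  have : Q j (spread alpha s (x0, u i)).
    by rewrite -Qij QE /=; exact: cell_spread.
  by rewrite QE /= cell_spread// spread_cell_eq//= !uN// => -[].
- by move=> i _; exists (spread_cell alpha s k (x0, u i)).
- move=> i iN; rewrite QE approx_fiber EFinM /= x0a; apply: lee_pmul => //.
  + by rewrite lee_fin ltW.
  + by apply: uniform_prob_bits_ge; rewrite uN.
Qed.

Lemma approx_dimLq s : dimLq (approx s) q = beta%:E.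
Proof.
(* Starting corners have countably many possible values, so one of them is taken with positive
   probability. *)
have [a pa] : exists a, (0 < mu [set x | start s x = a])%E.
  apply: countable_cover_gt0; first exact: measurable_start.
    by apply/seteqP; split => // x _; exists (start s x).
  by rewrite [X in (_ < X)%E](@probability_setT _ _ _ mu) lte01.
have mfin := fin_num_measure mu _ (measurable_start s a).
rewrite -(fineK mfin) lte_fin in pa.
apply: (@dimLq_of_bounds _ _ _ _ (fine (mu [set x | start s x = a])) _ s
  (fun k => m * n k)%N) => //.
  move=> k; split.
    by apply: (@approx_Lq_sum_ge _ _ a) => //; rewrite fineK.
  exact/Lq_sum_le/approx_dyadic_cube_le.
rewrite [X in _ --> X](_ : beta = m%:R * alpha); last first.
  by rewrite [RHS]mulrC divfK// gt_eqF// ltr0n.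
under eq_fun do rewrite natrM -mulrA.
by apply: cvgM; [exact: cvg_cst|exact: (cvg_digit_count alpha01)].
Qed.

Lemma approx_dL : PR mu -> (dL mu (approx s) @[s --> \oo] --> 0)%E.
Proof.
move=> mu1.
have X1 : (\int[P]_w (enorm (first_marginal w))%:E < +oo)%E.
  move: mu1; rewrite /PR /=.
  rewrite (@eq_measure_integral _ _ _ _ (distribution P first_marginal)).
    rewrite ge0_integral_pushforward//.
      by apply/measurable_EFinP; exact: measurable_enorm.
    by move=> x _; rewrite lee_fin enorm_ge0.
  by move=> A mA _; exact: first_marginalE.
apply: (squeeze_cvge _ (cvg_cst _)
  (@cvg_integral_enormB _ _ _ _ P first_marginal spread_mfun X1 _ _)).
- near=> s; apply/andP; split; last first.
    exact: (@dL_le_coupling _ _ _ _ P mu first_marginal (spread_mfun s)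
      first_marginalE X1 (approx_moment s)).
  (* The zero function shows [0 <= dL], the lower side of the squeeze. *)
  apply: ereal_sup_ubound => /=; exists (cst 0).
    by move=> x y; rewrite /cst subrr normr0 enorm_ge0.
  by rewrite !integral0 subee// abse0.
- by move=> s [x u] i; exact: spread_near.
- by move=> s [x u] i; exact: spread_dist.
Unshelve. all: by end_near.
Qed.

End approximation.

Theorem theorem3p18 (R : realType) (m : nat) (q : R) :
  (1 <= m)%N -> 1 < q ->
  forall beta : R, 0 <= beta <= m%:R -> dense_dL (@Sbeta R m q beta).
Proof.
move=> m1 q1 beta betam mu mu1 e e0.
have [s _ dLs] :
    (dL mu (approx m1 betam mu s) @[s --> \oo]) [set x | (x < e%:E)%E].
  apply: (approx_dL m1 betam mu1); apply: open_nbhs_nbhs.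
  by split; [exact: open_ereal_lt_ereal|rewrite /= lte_fin].
exists (approx m1 betam mu s); split; first exact: approx_PR; last first.
  exact: (dLs s (leqnn s)).
by split; [exact: approx_bounded_supp|exact: approx_dimLq].
Qed.
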